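(* Let $\overline{\mathcal{F}}$ be the set of overpartitions in which the first occurrence of a number may be overlined and no two adjacent parts are both overlined. Then $\overline{\mathcal{F}}$ is a separable overpartition class.
   Context: An overpartition (in the ''first occurrence'' convention) is a partition in which the first occurrence of a number may be overlined; parts are listed in non-increasing order of size, with $\overline{t}$ listed before the non-overlined copies of $t$. Adjacency refers to positions in this list. For a positive integer $t$ and nonnegative integer $d$, $\overline{t}+d=\overline{t+d}$. A separable overpartition class is a set $\mathcal{P}$ of overpartitions for which there is a subset $\mathcal{B}\subset\mathcal{P}$ (the basis) such that for each $m\geq 1$ the number of overpartitions in $\mathcal{B}$ with $m$ parts is finite, every overpartition in $\mathcal{P}$ with $m$ parts is uniquely of the form $(b_1+\pi_1,\ldots,b_m+\pi_m)$ with $(b_1,\ldots,b_m)\in\mathcal{B}$ and $(\pi_1,\ldots,\pi_m)$ a non-increasing sequence of nonnegative integers, and all overpartitions of this form lie in $\mathcal{P}$. *)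

(* Defs.v *)
From HB Require Import structures.
From mathcomp Require Import all_boot.
From mathcomp Require Import boolp classical_sets cardinality.

Set Implicit Arguments.
Unset Strict Implicit.
Unset Printing Implicit Defensive.

Local Open Scope classical_set_scope.

(* [(t, true)] is the overlined part t, [(t, false)] the non-overlined one. *)
Definition opart : Type := (nat * bool)%type.
HB.instance Definition _ := Choice.on opart.

(* [q] may directly follow [p]: sizes do not increase, and a part of the same
   size as its predecessor is not the first occurrence of that size, hence is
   not overlined. *)
Definition may_precede : rel opart :=
  fun p q => (q.1 < p.1) || ((q.1 == p.1) && ~~ q.2).

Definition is_overpartition (s : seq opart) : bool :=
  all (fun p => 0 < p.1) s && sorted may_precede s.

Record overpartition := Overpartition {
  oparts :> seq opart;
  opartsP : is_overpartition oparts }.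

HB.instance Definition _ := [isSub for oparts].
HB.instance Definition _ := [Choice of overpartition by <:].

Definition opart_add (p : opart) (d : nat) : opart := (p.1 + d, p.2).

(* (b_1 + pi_1, ..., b_m + pi_m); only used when both lists have size m. *)
Definition oparts_add (b : seq opart) (pi : seq nat) : seq opart :=
  [seq opart_add x.1 x.2 | x <- zip b pi].

Definition separable_overpartition_class (P : set overpartition) : Prop :=
  exists B : set overpartition,
    B `<=` P /\
    forall m : nat, 1 <= m ->
      [/\ finite_set [set b : overpartition | B b /\ size b = m],
          forall l : overpartition, P l -> size l = m ->
            exists! bpi : overpartition * seq nat,
              [/\ B bpi.1, size bpi.1 = m, size bpi.2 = m,
                  sorted geq bpi.2 & oparts l = oparts_add bpi.1 bpi.2]
        & forall (l b : overpartition) (pi : seq nat),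
            B b -> size b = m -> size pi = m -> sorted geq pi ->
            oparts l = oparts_add b pi -> P l].

Definition no_adjacent_overlined : set overpartition :=
  [set l | sorted (fun p q : opart => ~~ (p.2 && q.2)) l].

(* Adding a non-increasing sequence to an overpartition always gives an
   overpartition, so the closure clause above is never vacuous. *)
Lemma is_overpartition_add (b : overpartition) (pi : seq nat) :
  size pi = size b -> sorted geq pi -> is_overpartition (oparts_add b pi).
Proof.
case: b => b /= /andP[bpos bs] szpi pis; apply/andP; split.
  elim: b pi bpos szpi {bs pis} => [|p b IH] [|d pi] //= /andP[p0 b0] [sz].
  by rewrite addn_gt0 p0 /= IH.
case: b pi bs szpi pis {bpos} => [|p b] [|d pi] //= + [].
elim: b pi p d => [|q b IH] [|e pi] //= p d /andP[pq qb] [sz] /andP[ed epi].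
rewrite IH // andbT; move: pq; rewrite /may_precede /=.
case/orP => [lt|/andP[/eqP -> nq]].
  by rewrite -addSn leq_add.
by rewrite nq andbT ltn_add2l eqn_add2l orbC -leq_eqVlt.
Qed.

(* Main.v *)
From mathcomp Require Import all_boot.
From mathcomp Require Import classical_sets cardinality.
Require Import Defs.

Set Implicit Arguments.
Unset Strict Implicit.
Unset Printing Implicit Defensive.

Local Open Scope classical_set_scope.

(** For each pattern of overlines there is a smallest overpartition carrying it:
    its last part has size 1 and, read from right to left, the size grows by one
    exactly when passing an overlined part. The excess of any overpartition over
    the smallest one with the same pattern is non-increasing. Whether adjacent
    parts are both overlined depends on the pattern only, so the smallest
    overpartitions of the admissible patterns form a basis. *)

Definition marks (s : seq opart) : seq bool := [seq p.2 | p <- s].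

Fixpoint staircase (c : seq bool) : seq opart :=
  if c is a :: c' then ((count id c').+1, a) :: staircase c' else [::].

Lemma marks_staircase c : marks (staircase c) = c.
Proof. by elim: c => //= a c ->. Qed.

(** Passing an overlined part raises the count, so a size repeats only before a non-overlined part,
    as [may_precede] requires. *)
Lemma staircase_is_overpartition c : is_overpartition (staircase c).
Proof.
apply/andP; split; first by elim: c.
case: c => //= a c; elim: c a => //= b c IH a.
by rewrite IH andbT /may_precede /=; case: b; rewrite /= ?ltnSn ?eqxx ?orbT.
Qed.

Definition staircase_op c := Overpartition (staircase_is_overpartition c).

Lemma marks_add (b : seq opart) (pi : seq nat) :
  size pi = size b -> marks (oparts_add b pi) = marks b.
Proof.
by elim: b pi => [|p b IH] [|d pi] //= [/IH]; rewrite /oparts_add /= => ->.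
Qed.

Lemma oparts_add_inj (b : seq opart) (pi1 pi2 : seq nat) :
  size pi1 = size b -> size pi2 = size b ->
  oparts_add b pi1 = oparts_add b pi2 -> pi1 = pi2.
Proof.
elim: b pi1 pi2 => [|p b IH] [|d pi1] [|e pi2] //= [sz1] [sz2].
by rewrite /oparts_add /= => -[] /addnI -> /(IH _ _ sz1 sz2) ->.
Qed.

Lemma no_adjacent_overlined_marks (l : overpartition) :
  no_adjacent_overlined l = sorted (fun a b => ~~ (a && b)) (marks l) :> Prop.
Proof. by rewrite /no_adjacent_overlined /marks sorted_map. Qed.

Lemma overpartition_staircase_add (l : seq opart) : is_overpartition l ->
  exists pi, [/\ size pi = size l, sorted geq pi
    & l = oparts_add (staircase (marks l)) pi].
Proof.
elim: l => [|p l IH]; first by exists [::].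
case/andP => /= /andP[p0 lpos] pl.
have /IH[pi [szpi pis lE]] : is_overpartition l.
  by rewrite /is_overpartition lpos (path_sorted pl).
(* The first fact makes the truncated subtraction exact; the second says that the excess of [p] is
   at least the next one. *)
have [le_p path_pi] : count id (marks l) < p.1 /\
    path geq (p.1 - (count id (marks l)).+1) pi.
  case: l pi {IH lpos} szpi pis lE pl => [|q l] [|e pi] //= _ pis.
  case=> /(congr1 fst) /= qE _ /andP[pq _].
  (* By [qE], [q.1] is [(count id (marks l)).+1 + e]. If [q] is overlined, then [q.1 < p.1], and
     this strict drop pays for the extra overline counted to the right of [p]. *)
  suff le_pe : q.2 + count id (marks l) + e < p.1.
    have lt_p := leq_ltn_trans (leq_addr _ _) le_pe.
    by rewrite pis andbT leq_subRL.
  move: pq; rewrite /may_precede qE /=.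
  by case: (q.2); rewrite ?andbF ?orbF // andbT orbC -leq_eqVlt.
exists (p.1 - (count id (marks l)).+1 :: pi); split=> //=; first by rewrite szpi.
rewrite /oparts_add /= -/(oparts_add _ _) -lE /opart_add /= subnKC //.
by case: (p).
Qed.

Theorem theorem5p1 : separable_overpartition_class no_adjacent_overlined.
Proof.
exists [set b | no_adjacent_overlined b /\ b = staircase_op (marks b)].
split=> [b []//|m _]; split.
(* A basis element is determined by its marks, and only finitely many patterns have length [m]. *)
- apply: (@sub_finite_set _ _ (range (fun t : m.-tuple bool => staircase_op t))).
    move=> b [[_ bE] szb].
    have szm : size (marks b) == m by rewrite size_map szb.
    by exists (Tuple szm).
  exact/finite_image/finite_finset.
- move=> l lF szl; have [pi [szpi pis lE]] := overpartition_staircase_add (opartsP l).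
  have sz_st : size (staircase (marks l)) = m.
    by rewrite -(size_map snd) -/(marks _) marks_staircase size_map.
  exists (staircase_op (marks l), pi); split.
    split; rewrite ?szpi //=; split; last by rewrite marks_staircase.
    by move: lF; rewrite !no_adjacent_overlined_marks /= marks_staircase.
  case=> b pi' [/= [_ bE] szb szpi' _ lE'].
  (* Addition preserves marks, so those of [l] determine [b]; cancellation then determines [pi']. *)
  have mE : marks b = marks l by rewrite lE' marks_add // szb.
  rewrite mE in bE; rewrite bE in lE' *; congr pair.
  apply: (@oparts_add_inj (staircase (marks l))); rewrite ?sz_st ?szpi //.
  by rewrite -lE.
- move=> l b pi [bF _] szb szpi _ lE.
  by move: bF; rewrite !no_adjacent_overlined_marks lE marks_add // szb.
Qed.
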